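(* Let $n\ge2$ and $\mathfrak{g}=A_n^{(1)}$. For $k\in\mathbb{N}$ let $s_k=e_{-\alpha_1+k\delta}\circ e_{\alpha_1}$. The number of annihilating quasicones for which $s_k$ does not succeed for any $k\in\mathbb{N}$ is finite. That is, the set of quasicones $C$ in normal form for which there exist an irreducible non-dense weight $\mathfrak{g}$-module $V$, a weight $\mu$ in the root lattice coset containing $\mathrm{supp}(V)$ with $V_\mu=\{0\}$, an $\varepsilon\in\{1,\dots,n\}$ and a vector $v\in V_{\mu-\varepsilon\delta}$ with $\mathcal{A}nn(v)=C$, such that for no $k\in\mathbb{N}$ the composition $s_k$ is a successful strategy for $v$, is finite.
   Context: $\mathfrak{g}=A_n^{(1)}=\mathfrak{sl}_{n+1}(\mathbb{C})\otimes\mathbb{C}[t,t^{-1}]\oplus\mathbb{C}c\oplus\mathbb{C}d$, with Cartan subalgebra $\mathfrak{h}=\mathfrak{h}^\circ\oplus\mathbb{C}c\oplus\mathbb{C}d$, root system $\Delta$, imaginary roots $m\delta$ ($m\ne0$) and real roots $\alpha+m\delta$ ($\alpha\in\Delta^\circ$, $m\in\mathbb{Z}$), where $\Delta^\circ$ is the root system of $\mathfrak{sl}_{n+1}$ with simple roots $\Pi^\circ=\{\alpha_1,\dots,\alpha_n\}$ and positive roots $\Delta^\circ_+$. Write $e_{\alpha+m\delta}=e_\alpha\otimes t^m$ for root vectors. A weight module $V=\bigoplus_\lambda V_\lambda$ (of countable dimension) which is irreducible has support contained in a coset $\lambda+Q$ of the root lattice $Q$; it is non-dense if its support is a proper subset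 of this coset. A quasicone (subalgebra) is a subalgebra of the form $$C=\Big(\bigoplus_{\varphi\in\Delta^\circ}\bigoplus_{m\ge c_\varphi}\mathfrak{g}_{\varphi+m\delta}\Big)\oplus\big(\mathfrak{h}^\circ\otimes t\mathbb{C}[t]\big)$$ for integers $(c_\varphi)_{\varphi\in\Delta^\circ}$ with $c_\varphi+c_{-\varphi}\ge1$ for all $\varphi$, and $c_\varphi+c_\psi\ge c_{\varphi+\psi}$ whenever $\varphi,\psi,\varphi+\psi\in\Delta^\circ$. Its defect is $\#C=\sum_{\varphi\in\Delta^\circ_+}\max(c_\varphi+c_{-\varphi}-2,0)$. Positive roots are encoded by integers: $\alpha_{i+1}+\cdots+\alpha_{j+1}\leftrightarrow 2^i+\cdots+2^j$ ($0\le i\le j\le n-1$); the set of these integers is $I_n$, ordered as integers, and for $\kappa\in I_n$ corresponding to $\varphi$ put $c_{\kappa}=c_\varphi$, $c_{-\kappa}=c_{-\varphi}$. The quasicone $C$ is in normal form if $c_\varphi=1$ for all $\varphi\in\Pi^\circ$ and $c_\kappa+c_{-\kappa}\ge c_\nu+c_{-\nu}$ for all $\kappa<\nu$ in $I_n$. For $v\in V$, $\mathcal{A}nn(v)=\{g\in\mathfrak{g}\mid gv=0\}$. Elements of $\mathfrak{h}$ are disregarded: ''$\mathcal{A}nn(v)$ is the quasicone $C$'' means $\mathcal{A}nn(v)\cap\bigoplus_{\varphi\in\Delta}\mathfrak{g}_\varphi=C$. A strategy for $v$ (with $\mathcal{A}nn(v)$ a quasicone) is a composition $s=e_{\varphi_m}\circ\cdots\circ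 e_{\varphi_1}$ of root operators such that $sv\neq0$, $\mathcal{A}nn(sv)$ is again a quasicone, and the partial sums $\varphi_1+\cdots+\varphi_i$ are roots (for $s_k$ with $k=0$ the last partial sum is $0$, which is allowed). The strategy succeeds (is successful) if $\#\mathcal{A}nn(sv)<\#\mathcal{A}nn(v)$. *)

(* Defs.v *)
From HB Require Import structures.
From mathcomp Require Import all_boot all_order all_algebra.
From mathcomp Require Import complex.
From mathcomp Require Import boolp classical_sets functions cardinality fsbigop.
From mathcomp Require Import reals.

Set Implicit Arguments.
Unset Strict Implicit.
Unset Printing Implicit Defensive.

Import Order.TTheory GRing.Theory Num.Theory.
Local Open Scope classical_set_scope.
Local Open Scope ring_scope.

Section Subspaces.
Variables (K : pzRingType) (W : lmodType K).

Definition subspace (A : set W) : Prop :=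
  A 0 /\ forall (a : K) x y, A x -> A y -> A (a *: x + y).

Definition lin_span (A : set W) : set W := smallest subspace A.

End Subspaces.

Section LoopAlgebra.
Variables (R : realType) (n : nat).
Local Notation K := R[i].

(* An element of sl_{n+1} (x) K[t, t^-1] is a family x of traceless matrices,
   x m being the coefficient of t^m, almost all of which vanish. *)
Definition is_loop : {pred (int -> 'M[K]_n.+1)} := fun x =>
  `[< finite_set [set m | x m != 0] /\ forall m, \tr (x m) = 0 >].

Lemma is_loopP x :
  reflect (finite_set [set m | x m != 0] /\ forall m, \tr (x m) = 0)
          (x \in is_loop).
Proof. exact: asboolP. Qed.

Lemma is_loop_submod : submod_closed is_loop.
Proof.
split=> [|a x y /is_loopP[fx tx] /is_loopP[fy ty]].
  apply/is_loopP; split=> [|m]; last exact: mxtrace0.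
  rewrite (_ : [set _ | _] = set0) //.
  by rewrite -subset0 => m /=; rewrite eqxx.
apply/is_loopP; split=> [|m]; last by rewrite mxtraceD mxtraceZ tx ty mulr0 addr0.
apply: (@sub_finite_set _ _ ([set m | x m != 0] `|` [set m | y m != 0])).
  move=> m /=; have [xm|] := eqVneq (x m) 0; last by left.
  rewrite [X in X != 0](_ : _ = a *: x m + y m) // xm scaler0 add0r.
  by right.
by rewrite finite_setU.
Qed.

HB.instance Definition _ := GRing.isSubmodClosed.Build K _ is_loop is_loop_submod.

Record loop := Loop { loop_coef :> int -> 'M[K]_n.+1; _ : loop_coef \in is_loop }.
HB.instance Definition _ := [isSub for loop_coef].
HB.instance Definition _ := [Choice of loop by <:].
HB.instance Definition _ := [SubChoice_isSubLmodule of loop by <:].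

Lemma loopP (x : loop) : (x : int -> _) \in is_loop.
Proof. by case: x. Qed.

Lemma is_loop_monom (A : 'M[K]_n.+1) (m : int) :
  \tr A = 0 -> (fun k : int => if k == m then A else 0) \in is_loop.
Proof.
move=> trA; apply/is_loopP; split=> [|k]; last by case: ifP; rewrite ?mxtrace0.
apply: (@sub_finite_set _ _ [set m]) => // k /=.
by case: (k =P m) => // _; rewrite eqxx.
Qed.

Definition monom (A : 'M[K]_n.+1) (trA : \tr A = 0) (m : int) : loop :=
  Loop (is_loop_monom m trA).

Lemma is_loop_bracket (x y : loop) :
  (fun m : int => \sum_(k \in [set: int]) (x k *m y (m - k) - y (m - k) *m x k))
    \in is_loop.
Proof.
have [/is_loopP[fx tx] /is_loopP[fy ty]] := (loopP x, loopP y).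
apply/is_loopP; split=> [|m].
  apply: (@sub_finite_set _ _
    [set a + b | a in [set m | x m != 0] & b in [set m | y m != 0]]).
    move=> m /=; apply: contra_neqP => nm.
    apply: fsbig1 => k _.
    have [->|xk] := eqVneq (x k) 0; first by rewrite mul0mx mulmx0 subrr.
    have [->|yk] := eqVneq (y (m - k)) 0; first by rewrite mul0mx mulmx0 subrr.
    by case: nm; exists k => //; exists (m - k) => //; rewrite addrC subrK.
  exact: finite_image2.
elim/big_ind: _ => [|A B trA trB|k _]; first exact: mxtrace0.
- by rewrite mxtraceD trA trB addr0.
- by rewrite raddfB /= mxtrace_mulC subrr.
Qed.

Definition loop_bracket (x y : loop) : loop := Loop (is_loop_bracket x y).

Lemma is_loop_deriv (x : loop) : (fun m : int => m%:~R *: x m) \in is_loop.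
Proof.
have /is_loopP[fx tx] := loopP x.
apply/is_loopP; split=> [|m]; last by rewrite mxtraceZ tx mulr0.
apply: sub_finite_set fx => m /=; apply: contra_neq => ->.
exact: scaler0.
Qed.

(* t d/dt *)
Definition loop_deriv (x : loop) : loop := Loop (is_loop_deriv x).

End LoopAlgebra.

Section Affine.
Variables (R : realType) (n : nat).
Local Notation K := R[i].

(* (x, a, b) stands for x + a c + b d. *)
Definition affine : Type := (loop R n * K^o * K^o)%type.
HB.instance Definition _ := GRing.Lmodule.on affine.

Definition affine_loop (x : affine) : loop R n := x.1.1.
Definition affine_c (x : affine) : K := x.1.2.
Definition affine_d (x : affine) : K := x.2.

Definition of_loop (x : loop R n) : affine := (x, 0, 0).

(* [x t^m, y t^k] = [x, y] t^(m+k) + m delta_{m+k,0} tr(xy) c,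
   [d, x t^m] = m x t^m, and c is central. *)
Definition bracket (x y : affine) : affine :=
  (loop_bracket (affine_loop x) (affine_loop y)
     + affine_d x *: loop_deriv (affine_loop y)
     - affine_d y *: loop_deriv (affine_loop x),
   \sum_(k \in [set: int]) k%:~R * \tr (affine_loop x k *m affine_loop y (- k)),
   0).

Lemma bracket_monom (A B : 'M[K]_n.+1) (trA : \tr A = 0) (trB : \tr B = 0)
    (trAB : \tr (A *m B - B *m A) = 0) (m k : int) :
  bracket (of_loop (monom trA m)) (of_loop (monom trB k)) =
  (monom trAB (m + k), if m + k == 0 then m%:~R * \tr (A *m B) else 0, 0).
Proof.
rewrite /bracket /=; congr (_, _, _).
  rewrite /affine_loop /affine_d /= !scale0r subr0 addr0.
  apply: val_inj => /=; apply: funext => p.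
  rewrite -(@fsbig_widen _ _ _ _ [set m]) //; last first.
    by move=> j [_ /= /eqP/negPf ->]; rewrite mul0mx mulmx0 subrr.
  rewrite fsbig_set1 eqxx (_ : (p - m == k) = (p == m + k)); last by rewrite subr_eq (addrC k).
  by case: eqP => // _; rewrite mul0mx mulmx0 subrr.
rewrite /affine_loop /= -(@fsbig_widen _ _ _ _ [set m]) //; last first.
  by move=> j [_ /= /eqP/negPf ->]; rewrite mul0mx mxtrace0 mulr0.
rewrite fsbig_set1 eqxx (_ : (- m == k) = (m + k == 0)); last by rewrite -oppr_eq0 opprD subr_eq0.
by case: eqP => // _; rewrite mulmx0 mxtrace0 mulr0.
Qed.

Record cartan := Cartan {
  cartan_val :> affine;
  cartan_diag : is_diag_mx (affine_loop cartan_val 0);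
  cartan_deg0 : forall m, m != 0 -> affine_loop cartan_val m = 0
}.

(* Functions on the Cartan subalgebra h. Those that occur below, namely roots,
   and translates by the root lattice of functions with a nonzero weight space,
   are linear forms, i.e., elements of h^*. *)
Definition weight : Type := cartan -> K.
HB.instance Definition _ := GRing.Zmodule.on weight.

(* (i, j) stands for the root epsilon_i - epsilon_j of sl_{n+1}. *)
Record finroot := FinRoot { finroot_val : 'I_n.+1 * 'I_n.+1;
                        finroot_neq : finroot_val.1 != finroot_val.2 }.
HB.instance Definition _ := [isSub for finroot_val].
HB.instance Definition _ := [Finite of finroot by <:].

Definition finroot_pos (f : finroot) : bool := ((finroot_val f).1 < (finroot_val f).2)%N.

Lemma finroot_opp_subproof (f : finroot) : (finroot_val f).2 != (finroot_val f).1.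
Proof. by rewrite eq_sym finroot_neq. Qed.

Definition finroot_opp (f : finroot) : finroot :=
  @FinRoot ((finroot_val f).2, (finroot_val f).1) (finroot_opp_subproof f).

Lemma simple_root_subproof (i : 'I_n) :
  widen_ord (leqnSn n) i != lift ord0 i.
Proof. by rewrite -val_eqE /= /bump /= add1n neq_ltn ltnSn. Qed.

(* The index i : 'I_n starts at 0, so that this is alpha_(i+1). *)
Definition simple_root (i : 'I_n) : finroot :=
  @FinRoot (widen_ord (leqnSn n) i, lift ord0 i) (simple_root_subproof i).

Definition finroot_weight (f : finroot) : weight := fun h =>
  affine_loop h 0 (finroot_val f).1 (finroot_val f).1
  - affine_loop h 0 (finroot_val f).2 (finroot_val f).2.

Definition delta : weight := fun h => affine_d h.

Definition real_root_weight (r : finroot * int) : weight :=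
  finroot_weight r.1 + delta *~ r.2.

Definition Delta : set weight :=
  range real_root_weight `|` [set delta *~ m | m in [set m : int | m != 0]].

Definition root_lattice : set weight :=
  [set w | exists (k : 'I_n -> int) (m : int),
     w = \sum_i finroot_weight (simple_root i) *~ k i + delta *~ m].

Definition root_coset (l : weight) : set weight :=
  [set mu | root_lattice (mu - l)].

Lemma tr_root_vector (f : finroot) :
  \tr (delta_mx (finroot_val f).1 (finroot_val f).2 : 'M[K]_n.+1) = 0.
Proof.
rewrite /mxtrace big1 // => i _; rewrite mxE.
by case: eqP => // ->; rewrite (negPf (finroot_neq f)).
Qed.

(* e_(phi + m delta) = e_phi (x) t^m for r = (phi, m) *)
Definition root_vector (r : finroot * int) : affine :=
  of_loop (monom (tr_root_vector r.1) r.2).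

Definition root_space (w : weight) : set affine :=
  [set x | forall h : cartan, bracket h x = w h *: x].

Definition root_part : set affine :=
  lin_span (\bigcup_(w in Delta) root_space w).

(* h_0 (x) t K[t], where h_0 is the Cartan subalgebra of sl_{n+1} *)
Definition heisenberg_pos : set affine :=
  [set of_loop x | x in [set x : loop R n |
     forall m, is_diag_mx (x m) /\ (x m != 0 -> 0 < m)]].

Definition quasicone (c : finroot -> int) : set affine :=
  lin_span ((\bigcup_(r in [set r : finroot * int | c r.1 <= r.2])
           root_space (real_root_weight r)) `|` heisenberg_pos).

Definition quasicone_data (c : finroot -> int) : Prop :=
  (forall f, 1 <= c f + c (finroot_opp f)) /\
  (forall f g h, finroot_weight f + finroot_weight g = finroot_weight h ->
     c h <= c f + c g).

Definition defect (c : finroot -> int) : int :=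
  \sum_(f | finroot_pos f) Num.max (c f + c (finroot_opp f) - 2) 0.

(* alpha_(i+1) + ... + alpha_(j+1) is the pair (i, j+1), and is sent to
   2^i + ... + 2^j. *)
Definition root_code (f : finroot) : nat :=
  \sum_((finroot_val f).1 <= k < (finroot_val f).2) 2 ^ k.

Definition normal_form (c : finroot -> int) : Prop :=
  (forall i, c (simple_root i) = 1) /\
  (forall f g, finroot_pos f -> finroot_pos g -> (root_code f < root_code g)%N ->
     c g + c (finroot_opp g) <= c f + c (finroot_opp f)).

Section Modules.
Variables (V : lmodType K) (act : affine -> V -> V).

Definition is_module : Prop :=
  [/\ forall a x y v, act (a *: x + y) v = a *: act x v + act y v,
      forall a x u v, act x (a *: u + v) = a *: act x u + act x v &
      forall x y v, act (bracket x y) v = act x (act y v) - act y (act x v)].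

Definition submodule (W : set V) : Prop :=
  subspace W /\ forall x v, W v -> W (act x v).

Definition irreducible : Prop :=
  (exists v : V, v != 0) /\
  forall W, submodule W -> W = [set 0] \/ W = [set: V].

Definition weight_space (l : weight) : set V :=
  [set v | forall h : cartan, act h v = l h *: v].

(* The sum of the weight spaces is automatically direct. *)
Definition weight_module : Prop := lin_span (\bigcup_l weight_space l) = [set: V].

Definition countable_dim : Prop :=
  exists b : nat -> V, lin_span (range b) = [set: V].

Definition supp : set weight := [set l | weight_space l != [set 0]].

(* For irreducible V, supp is contained in the coset of any of its elements. *)
Definition non_dense : Prop :=
  exists2 l, supp l & supp `<` root_coset l.

Definition ann (v : V) : set affine := [set x | act x v = 0].

Definition ann_is (v : V) (C : set affine) : Prop := ann v `&` root_part = C.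

(* [:: r_1; ...; r_m] encodes the operator e_(r_m) o ... o e_(r_1). *)
Definition apply_roots (s : seq (finroot * int)) (v : V) : V :=
  foldl (fun u r => act (root_vector r) u) v s.

Definition partial_sum (s : seq (finroot * int)) (i : nat) : weight :=
  \sum_(r <- take i s) real_root_weight r.

Definition strategy (s : seq (finroot * int)) (v : V) : Prop :=
  [/\ exists2 c, quasicone_data c & ann_is v (quasicone c),
      apply_roots s v != 0,
      exists2 c, quasicone_data c & ann_is (apply_roots s v) (quasicone c) &
      forall i, (0 < i <= size s)%N ->
        Delta (partial_sum s i) \/ (i = size s /\ partial_sum s i = 0)].

(* The defect of a quasicone is read off its defining integers, which it
   determines. *)
Definition successful (s : seq (finroot * int)) (v : V) : Prop :=
  strategy s v /\
  exists c c', [/\ quasicone_data c, ann_is v (quasicone c),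
    quasicone_data c', ann_is (apply_roots s v) (quasicone c') &
    defect c' < defect c].

End Modules.

(* e_(-alpha_1 + k delta) o e_(alpha_1) *)
Definition s_ (n1 : (1 < n)%N) (k : nat) : seq (finroot * int) :=
  let alpha1 := simple_root (Ordinal (ltnW n1)) in
  [:: (alpha1, 0); (finroot_opp alpha1, k%:Z)].

End Affine.

Arguments Delta {R n}.
Arguments delta {R n}.

(* Main.v *)
Require Import Defs.
From mathcomp Require Import all_boot all_order all_algebra.
From mathcomp Require Import complex.
From mathcomp Require Import boolp classical_sets functions cardinality.
From mathcomp Require Import reals.
From mathcomp Require Import fsbigop zify ring.

Import Order.TTheory GRing.Theory Num.Theory.
Local Open Scope classical_set_scope.
Local Open Scope ring_scope.

(* Let f be a simple root, e_f the root vector, and suppose c_(-f) > 2 eps.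
   As c_f = 1, the vectors u = e_f v and z = e_(-f + 2 eps delta) v are both
   nonzero.  With gamma = -f + eps delta they lie in V_(mu - gamma) and
   V_(mu + gamma), so V_mu = 0 gives e_gamma u = 0 and e_(-gamma) z = 0.  By
   irreducibility and ad-nilpotency, e_gamma and e_(-gamma) are then locally
   nilpotent on V, so u is a highest weight vector and z a lowest weight vector
   for an integrable sl_2: the coroot of gamma has eigenvalue >= 0 on u and
   <= 0 on z, although the latter exceeds the former by 4.  Hence
   c_(-f) <= 2 eps <= 2 n for every simple f, and the quasicone inequalities
   bound all the integers of C. *)

(** * Highest weight vectors of sl_2 *)

Section Sl2.
Variables (K : numFieldType) (V : lmodType K).

(** By induction, e f^(k+1) u = (k+1)(a - k) f^k u, so at the first power f^(k+1) that kills [u] the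
    factor a - k has to vanish. *)
Lemma sl2_highest_weight_nat (e f h : V -> V) (a : K) (u : V) (N : nat) :
  linear e -> linear f ->
  (forall w, e (f w) - f (e w) = h w) ->
  (forall w, h (f w) = f (h w) - 2 *: f w) ->
  u != 0 -> e u = 0 -> h u = a *: u -> iter N f u = 0 ->
  exists k : nat, a = k%:R.
Proof.
move=> le lf ef hf u0 eu hu fN.
have l0 (g : V -> V) : linear g -> g 0 = 0.
  by move=> lg; have := lg (-1) 0 0; rewrite scaler0 addr0 scaleN1r addNr.
have lZ (g : V -> V) : linear g -> forall b w, g (b *: w) = b *: g w.
  by move=> lg b w; rewrite -[b *: w]addr0 lg (l0 g) // addr0.
have hk k : h (iter k f u) = (a - 2 *+ k) *: iter k f u.
  elim: k => [|k IH] /=; first by rewrite mulr0n subr0.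
  rewrite hf IH (lZ f) // -scalerBl; congr (_ *: _); ring.
have ek k : e (iter k.+1 f u) = (k.+1%:R * (a - k%:R)) *: iter k f u.
  elim: k => [|k IH].
    by rewrite subr0 mul1r /= -hu -ef eu (l0 f) // subr0.
  have -> : e (iter k.+2 f u) = h (iter k.+1 f u) + f (e (iter k.+1 f u)).
    by rewrite -ef subrK.
  rewrite hk IH (lZ f) // -scalerDl; congr (_ *: _).
  ring.
elim: N fN => [/= /eqP|N IH fN]; first by rewrite (negPf u0).
have /eqP := ek N; rewrite fN (l0 e) // eq_sym.
rewrite scaler_eq0 mulf_eq0 pnatr_eq0 /= subr_eq0 => /orP[/eqP->|/eqP/IH//].
by exists N.
Qed.

End Sl2.

(** The booleans compare the end points of two finite roots, and the right-hand side is the pairing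
    of one with the coroot of the other. In characteristic 0 the equation becomes 2 + q + r = p + s
    in the natural numbers, which leaves only p = s = 1. *)
Lemma coroot_pairing_eq2 (K : numDomainType) (p q r s : bool) :
  1%:R + 1%:R = p%:R - q%:R - r%:R + s%:R :> K -> p && s.
Proof.
move=> H; have {H} : (2 + q + r)%:R == (p + s)%:R :> K.
  rewrite -subr_eq0 !natrD.
  have -> : 2%:R + q%:R + r%:R - (p%:R + s%:R)
      = 1%:R + 1%:R - (p%:R - q%:R - r%:R + s%:R) :> K by ring.
  by rewrite H subrr.
by rewrite eqr_nat; case: p q r s => -[] [] [].
Qed.

(** * Matrix coefficients and root vectors of the affine algebra *)

Section Affine.
Variables (R : realType) (n : nat).
Local Notation K := R[i].
Local Notation affine := (affine R n).
Implicit Types (x : affine) (r : finroot n * int) (f : finroot n).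

Definition root_mx f : 'M[K]_n.+1 := delta_mx (finroot_val f).1 (finroot_val f).2.

Lemma root_mx_sqr f : root_mx f *m root_mx f = 0.
Proof. by rewrite mul_delta_mx_0 // eq_sym finroot_neq. Qed.

Lemma loop_bracket_monoml (A : 'M[K]_n.+1) (trA : \tr A = 0) m (y : loop R n) p :
  loop_bracket (monom trA m) y p = A *m y (p - m) - y (p - m) *m A.
Proof.
rewrite /= -(@fsbig_widen _ _ _ _ [set m]) //; last first.
  by move=> j [_ /= /eqP/negPf ->]; rewrite mul0mx mulmx0 subrr.
by rewrite fsbig_set1 eqxx.
Qed.

Lemma affine_loop_cartan (h : cartan R n) k :
  affine_loop h k = if k == 0 then affine_loop h 0 else 0.
Proof. by case: eqP => [->|/eqP/cartan_deg0]. Qed.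

Lemma affine_loop_bracket_cartan (h : cartan R n) x p :
  affine_loop (bracket h x) p =
  affine_loop h 0 *m affine_loop x p - affine_loop x p *m affine_loop h 0
    + affine_d h *: (p%:~R *: affine_loop x p).
Proof.
have -> : affine_loop (bracket h x) p =
  loop_bracket (affine_loop h) (affine_loop x) p
  + affine_d h *: (p%:~R *: affine_loop x p)
  - affine_d x *: (p%:~R *: affine_loop h p) by [].
(* In degree 0 the factor [p] vanishes, in every other degree [h] does. *)
have -> : p%:~R *: affine_loop h p = 0.
  by rewrite affine_loop_cartan; case: eqP => [->|_]; rewrite ?scale0r ?scaler0.
rewrite scaler0 subr0; congr (_ + _).
rewrite /= -(@fsbig_widen _ _ _ _ [set 0]) //; last first.
  move=> j [_ /= /eqP/negPf j0].
  by rewrite affine_loop_cartan j0 mul0mx mulmx0 subrr.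
by rewrite fsbig_set1 subr0.
Qed.

(** ad h is diagonal on the matrix units E_ij t^p, so weights can be compared one entry at a
    time. *)
Lemma affine_loop_bracket_cartanE (h : cartan R n) x p i j :
  affine_loop (bracket h x) p i j =
  (affine_loop h 0 i i - affine_loop h 0 j j + affine_d h * p%:~R)
    * affine_loop x p i j.
Proof.
rewrite affine_loop_bracket_cartan !mxE.
have /is_diag_mxP hd := cartan_diag h.
rewrite (bigD1 i) //= big1 ?addr0; last first.
  by move=> k ki; rewrite hd ?mul0r // eq_sym.
rewrite (bigD1 j) //= big1 ?addr0; last by move=> k kj; rewrite hd ?mulr0.
ring.
Qed.

Lemma root_vectorE r p i j :
  affine_loop (root_vector R r) p i j =
  ((p == r.2) && (i == (finroot_val r.1).1) && (j == (finroot_val r.1).2))%:R.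
Proof. by rewrite /root_vector /=; case: eqP; rewrite mxE. Qed.

Lemma weightMz (w : weight R n) (m : int) h : (w *~ m) h = w h *~ m.
Proof.
have E k : (w *+ k) h = w h *+ k.
  elim: k => [//|k IH].
  by rewrite !mulrS -IH.
case: m => k; first by rewrite -!pmulrn E.
by rewrite !NegzE !mulrNz -!pmulrn -E.
Qed.

Lemma real_root_weightE r (h : cartan R n) : real_root_weight r h =
  affine_loop h 0 (finroot_val r.1).1 (finroot_val r.1).1
  - affine_loop h 0 (finroot_val r.1).2 (finroot_val r.1).2
  + affine_d h * r.2%:~R.
Proof. by rewrite mulrzr -(weightMz delta). Qed.

Lemma root_vector_root_space r : root_space (real_root_weight r) (root_vector R r).
Proof.
move=> h; rewrite [LHS]surjective_pairing [X in (X, _)]surjective_pairing.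
have Z (a : K) (y : affine) : a *: y = (a *: y.1.1, a * y.1.2, a * y.2) by [].
rewrite Z; congr (_, _, _).
- apply: val_inj; apply: funext => p; apply/matrixP => i j.
  rewrite [LHS](affine_loop_bracket_cartanE h).
  have -> : forall a (y : loop R n), \val (a *: y) p i j = a * y p i j.
    by move=> a y; rewrite /= [LHS]mxE.
  rewrite -/(affine_loop _) root_vectorE.
  case: eqP => [->|_] /=; last by rewrite !mulr0.
  case: eqP => [->|_] /=; last by rewrite !mulr0.
  case: eqP => [->|_] /=; last by rewrite !mulr0.
  by rewrite !mulr1 real_root_weightE.
- rewrite mulr0; apply: fsbig1 => k _.
  by rewrite affine_loop_cartan; case: eqP => [->|]; rewrite ?mul0r ?mul0mx ?mxtrace0 ?mulr0.
- by rewrite mulr0.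
Qed.

(** * Coroots and the derivation d *)

Definition coroot_mx f : 'M[K]_n.+1 :=
  delta_mx (finroot_val f).1 (finroot_val f).1
    - delta_mx (finroot_val f).2 (finroot_val f).2.

Lemma root_mx_comm f :
  root_mx f *m root_mx (finroot_opp f) - root_mx (finroot_opp f) *m root_mx f
  = coroot_mx f.
Proof. by rewrite !mul_delta_mx. Qed.

Lemma tr_coroot f : \tr (coroot_mx f) = 0.
Proof. by rewrite -root_mx_comm raddfB /= mxtrace_mulC subrr. Qed.

Lemma coroot_mx_diag f : is_diag_mx (coroot_mx f).
Proof.
apply/is_diag_mxP => i j ij; rewrite !mxE.
have E (k : 'I_n.+1) : (i == k) && (j == k) = false.
  by apply/negP => /andP[/eqP ik /eqP jk]; rewrite ik jk eqxx in ij.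
by rewrite !E subrr.
Qed.

Section Coroot.
Variables (f : finroot n) (a : K).

(* f^vee + a c *)
Definition coroot_affine : affine := (monom (tr_coroot f) 0, a, 0).

Lemma coroot_affine_diag : is_diag_mx (affine_loop coroot_affine 0).
Proof. exact: coroot_mx_diag. Qed.

Lemma coroot_affine_deg0 m : m != 0 -> affine_loop coroot_affine m = 0.
Proof. by move=> /= /negPf ->. Qed.

(** The coefficient [a] of c stays free: brackets of opposite real root vectors produce a multiple
    of c, on which all real roots vanish. *)
Definition coroot : cartan R n := Cartan coroot_affine_diag coroot_affine_deg0.

Lemma real_root_weight_coroot (r : finroot n * int) :
  real_root_weight r coroot =
  ((finroot_val r.1).1 == (finroot_val f).1)%:R
  - ((finroot_val r.1).1 == (finroot_val f).2)%:R
  - ((finroot_val r.1).2 == (finroot_val f).1)%:R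
  + ((finroot_val r.1).2 == (finroot_val f).2)%:R.
Proof.
rewrite real_root_weightE /= !mxE !andbb mul0r addr0; ring.
Qed.

End Coroot.

Lemma dcartan_diag : is_diag_mx (affine_loop ((0, 0, 1) : affine) 0).
Proof. exact: mx0_is_diag. Qed.

Definition dcartan : cartan R n := @Cartan R n (0, 0, 1) dcartan_diag (fun _ _ => erefl).

Lemma real_root_weight_dcartan r : real_root_weight r dcartan = r.2%:~R.
Proof. by rewrite real_root_weightE /= !mxE subrr add0r mul1r. Qed.

(** * Matrix entries of root spaces and quasicones *)

Lemma affine_loopD x y m : affine_loop (x + y) m = affine_loop x m + affine_loop y m.
Proof. by []. Qed.

Lemma affine_loopZ (a : K) x m : affine_loop (a *: x) m = a *: affine_loop x m.
Proof. by []. Qed.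

(** ad h scales the entry at [f] in degree [m] by either side of the equation, and a nonzero entry
    can be cancelled. *)
Lemma root_space_real_root_weight r x f m (h : cartan R n) :
  root_space (real_root_weight r) x ->
  affine_loop x m (finroot_val f).1 (finroot_val f).2 != 0 ->
  real_root_weight (f, m) h = real_root_weight r h.
Proof.
move=> rx xN0; apply: (mulIf xN0).
by rewrite real_root_weightE -affine_loop_bracket_cartanE rx affine_loopZ [LHS]mxE.
Qed.

(** d recovers the degree. The coroot of [f] recovers the finite part, since [f] is the only finite
    root that pairs to 2 with it. *)
Lemma real_root_weight_inj r r' :
  (forall h : cartan R n, real_root_weight r h = real_root_weight r' h) -> r = r'.
Proof.
case: r r' => [f m] [g k] key.
have := key dcartan; rewrite !real_root_weight_dcartan => /intr_inj /= ->.
have := key (coroot f 0); rewrite !real_root_weight_coroot /= !eqxx.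
have /negPf fN := finroot_neq f; rewrite (eq_sym _.2) fN.
rewrite subr0 subr0 => /coroot_pairing_eq2 /andP[/eqP gf1 /eqP gf2].
congr pair; apply: val_inj; symmetry.
by rewrite [LHS]surjective_pairing gf1 gf2 -surjective_pairing.
Qed.

Lemma root_space_loopE r x f m : root_space (real_root_weight r) x ->
  affine_loop x m (finroot_val f).1 (finroot_val f).2 != 0 -> r = (f, m).
Proof.
move=> rx xN0; apply: real_root_weight_inj => h; symmetry.
exact: root_space_real_root_weight xN0.
Qed.

(** The condition [P] defines a subspace, so it suffices to check the generators of the span. *)
Lemma quasicone_loopE (c : finroot n -> int) x f m : quasicone c x ->
  affine_loop x m (finroot_val f).1 (finroot_val f).2 != 0 -> c f <= m.
Proof.
pose P := [set y : affine | affine_loop y m (finroot_val f).1 (finroot_val f).2 != 0 -> c f <= m].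
move=> /(_ P); apply; split.
  split; first by rewrite /P /= mxE eqxx.
  move=> a y z Py Pz; rewrite /P /mkset affine_loopD affine_loopZ !mxE.
  have [->|y0 _] := eqVneq (affine_loop y m (finroot_val f).1 (finroot_val f).2) 0.
    by rewrite mulr0 add0r.
  exact: (Py y0).
move=> y [[r /= cr ry]|[z zd <-]].
  by move=> /(root_space_loopE _ _ _ _ ry) rE; rewrite rE in cr.
(* Heisenberg elements are diagonal, so their entries at root positions vanish. *)
move=> /=; have [/is_diag_mxP zd0 _] := zd m.
by rewrite zd0 ?eqxx //; have := finroot_neq f.
Qed.

Lemma root_vector_root_part r : root_part (root_vector R r).
Proof.
move=> P [_ sP]; apply: sP; exists (real_root_weight r); first by left; exists r.
exact: root_vector_root_space.
Qed.

Lemma root_vector_notin_quasicone (c : finroot n -> int) f m : m < c f ->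
  ~ quasicone c (root_vector R (f, m)).
Proof.
move=> mc /(quasicone_loopE _ _ f m); rewrite root_vectorE /= !eqxx oner_eq0.
by move=> /(_ isT); rewrite leNgt mc.
Qed.

(** * Brackets with a root vector *)

Lemma bracket_root_vector_opp f m : exists a : K,
  bracket (root_vector R (f, m)) (root_vector R (finroot_opp f, - m)) = coroot f a.
Proof.
have trAB : \tr (root_mx f *m root_mx (finroot_opp f) - root_mx (finroot_opp f) *m root_mx f) = 0.
  by rewrite root_mx_comm tr_coroot.
rewrite /root_vector (bracket_monom _ _ trAB) /= subrr.
eexists; rewrite /coroot_affine; congr (_, _, _).
by apply: val_inj; rewrite /= root_mx_comm.
Qed.

Lemma affine_loop_ad_root_vector r x p :
  affine_loop (bracket (root_vector R r) x) p =
  root_mx r.1 *m affine_loop x (p - r.2) - affine_loop x (p - r.2) *m root_mx r.1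
    - (affine_d x * (if p == r.2 then p%:~R else 0)) *: root_mx r.1.
Proof.
have -> : affine_loop (bracket (root_vector R r) x) p =
    loop_bracket (affine_loop (root_vector R r)) (affine_loop x) p
    + 0 *: (p%:~R *: affine_loop x p)
    - affine_d x *: (p%:~R *: affine_loop (root_vector R r) p) by [].
rewrite scale0r addr0 loop_bracket_monoml /=; congr (_ - _).
by rewrite scalerA; case: eqP => _; rewrite ?mulr0 ?scaler0 ?scale0r.
Qed.

(** As E^2 = 0, one bracket gives a [y] with E y E = 0, and the next a [z] with E z = z E = 0. Then
    the third bracket has no loop part, and its central term is a multiple of the trace of a product
    E z. *)
Lemma ad_root_vector_cube r x : iter 3 (bracket (root_vector R r)) x = 0.
Proof.
set E := root_mx r.1; have EE : E *m E = 0 := root_mx_sqr r.1.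
pose y := bracket (root_vector R r) x; pose z := bracket (root_vector R r) y.
have Ey p : E *m affine_loop y p *m E = 0.
  rewrite affine_loop_ad_root_vector -/E !(mulmxBr, mulmxBl) -scalemxAr.
  by rewrite !mulmxA EE !mul0mx -!mulmxA EE !mulmx0 scaler0 mul0mx !subr0.
(* Being a bracket, [y] has no d component, so the derivation term drops out. *)
have zE p : affine_loop z p = E *m affine_loop y (p - r.2) - affine_loop y (p - r.2) *m E.
  by rewrite affine_loop_ad_root_vector mul0r scale0r subr0.
have Ez p : E *m affine_loop z p = 0.
  by rewrite zE mulmxBr !mulmxA EE mul0mx Ey subrr.
have zE0 p : affine_loop z p *m E = 0.
  by rewrite zE mulmxBl Ey -mulmxA EE mulmx0 subrr.
rewrite /= -/y -/z; congr (_, _, _).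
- apply: val_inj; apply: funext => p.
  rewrite -[LHS]/(affine_loop (bracket (root_vector R r) z) p).
  by rewrite affine_loop_ad_root_vector -/E Ez zE0 mul0r scale0r !subr0.
- apply: fsbig1 => k _ /=; case: eqP => _; last by rewrite mul0mx mxtrace0 mulr0.
  by rewrite -/(root_mx r.1) Ez mxtrace0 mulr0.
Qed.

Lemma finroot_oppK f : finroot_opp (finroot_opp f) = f.
Proof. by apply: val_inj => /=; rewrite -surjective_pairing. Qed.

Lemma real_root_weight_addopp f m k :
  real_root_weight (f, m) + real_root_weight (finroot_opp f, k)
  = delta *~ (m + k) :> weight R n.
Proof.
have -> : real_root_weight (finroot_opp f, k) = - finroot_weight f + delta *~ k :> weight R n.
  by apply: funext => h; rewrite /real_root_weight; congr (_ + _); exact/esym/opprB.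
by rewrite /real_root_weight /= addrACA subrr add0r mulrzDr.
Qed.

(** * Local nilpotency on irreducible modules *)

Section Modules.
Variables (V : lmodType K) (act : affine -> V -> V).
Hypothesis modV : is_module act.

Lemma act_linear x : linear (act x).
Proof. by case: modV => _ lin _ a u v; exact: lin. Qed.

Lemma act0 x : act x 0 = 0.
Proof. by have := act_linear x (-1) 0 0; rewrite scaler0 addr0 scaleN1r addNr. Qed.

Lemma actZ x (a : K) v : act x (a *: v) = a *: act x v.
Proof. by rewrite -[a *: v]addr0 act_linear act0 addr0. Qed.

Lemma act_linearl a x y v : act (a *: x + y) v = a *: act x v + act y v.
Proof. by case: modV => lin _ _; exact: lin. Qed.

Lemma act0l v : act 0 v = 0.
Proof. by have := act_linearl (-1) 0 0 v; rewrite scaler0 addr0 scaleN1r addNr. Qed.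

Lemma actZl (a : K) x v : act (a *: x) v = a *: act x v.
Proof. by rewrite -[a *: x]addr0 act_linearl act0l addr0. Qed.

Lemma act_bracket x y v : act (bracket x y) v = act x (act y v) - act y (act x v).
Proof. by case: modV. Qed.

Lemma iter_act_linear x k : linear (iter k (act x)).
Proof. by elim: k => [|k IH] a u v //=; rewrite IH act_linear. Qed.

Lemma iter_act0 x k : iter k (act x) 0 = 0.
Proof. by elim: k => //= k ->; rewrite act0. Qed.

Lemma iter_act_add x k m v : iter k (act x) v = 0 -> iter (m + k) (act x) v = 0.
Proof. by move=> vk; rewrite iterD vk iter_act0. Qed.

(** This is the Leibniz rule: x y v = [x, y] v + y (x v), where the first summand lowers [p] and the
    second lowers [k]. Hence the induction on k + p, with [y] and [v] varying. *)
Lemma ad_nilpotent_iter_act x y k p v :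
  iter p (bracket x) y = 0 -> iter k (act x) v = 0 ->
  iter (k + p) (act x) (act y v) = 0.
Proof.
have [m] := ubnP (k + p); elim: m => // m IH in y k p v *.
case: k => [_ _ /= ->|k]; first by rewrite act0 iter_act0.
case: p => [_ /= -> _|p]; first by rewrite act0l iter_act0 act0.
rewrite addSn ltnS => km yp vk.
have IH1 : iter (k + p.+1) (act x) (act (bracket x y) v) = 0.
  by rewrite addnS -addSn; apply: IH; rewrite ?iterSr // -?iterSr // addSn -addnS.
have IH2 : iter (k + p.+1) (act x) (act y (act x v)) = 0.
  by apply: IH; rewrite // -iterSr.
rewrite iterSr -[act x (act y v)](subrK (act y (act x v))) -act_bracket.
by rewrite -[X in iter _ _ (X + _)]scale1r iter_act_linear IH1 IH2 scaler0 addr0.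
Qed.

(** The vectors killed by some power of the root vector form a submodule, because its adjoint action
    has cube 0. This submodule contains [u], so it is all of V. *)
Lemma root_vector_locally_nilpotent r u :
  irreducible act -> u != 0 -> act (root_vector R r) u = 0 ->
  forall v, exists k, iter k (act (root_vector R r)) v = 0.
Proof.
move=> [_ irr] u0 eu.
pose W := [set v | exists k, iter k (act (root_vector R r)) v = 0].
have subW : submodule act W.
  split; last first.
    move=> x v [k vk]; exists (k + 3)%N; apply: ad_nilpotent_iter_act vk.
    exact: ad_root_vector_cube.
  split; first by exists 0%N.
  move=> a v w [k vk] [m wm]; exists (k + m)%N.
  by rewrite iter_act_linear {1}addnC !iter_act_add // scaler0 addr0.
have Wu : W u by exists 1%N.
have [W0|WT] := irr W subW; last by move=> v; have : W v by rewrite WT.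
by move: Wu u0; rewrite W0 /= => ->; rewrite eqxx.
Qed.

Lemma act_root_space (w l : weight R n) x v :
  root_space w x -> weight_space act l v -> weight_space act (l + w) (act x v).
Proof.
move=> wx lv h; rewrite -[LHS](subrK (act x (act h v))) -act_bracket wx actZl.
by rewrite lv actZ -scalerDl addrC.
Qed.

(** * The sl_2 argument bounding [c] at the opposite root *)

Lemma opp_root_bound (c : finroot n -> int) f (mu : weight R n) (eps : nat) v :
  irreducible act -> weight_space act mu = [set 0] ->
  weight_space act (mu - delta *+ eps) v -> ann_is act v (quasicone c) ->
  c f = 1 -> c (finroot_opp f) <= (eps + eps)%:Z.
Proof.
move=> irr mu0 wv annv cf; rewrite leNgt; apply/negP => c_big.
(* Among root vectors, [v] is killed only by those in the quasicone. *)
have nz g m : m < c g -> act (root_vector R (g, m)) v != 0.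
  move=> mc; apply/eqP => av; apply: (root_vector_notin_quasicone _ _ _ mc).
  by rewrite -annv; split=> //; exact: root_vector_root_part.
pose u := act (root_vector R (f, 0)) v.
pose z := act (root_vector R (finroot_opp f, (eps + eps)%:Z)) v.
have u0 : u != 0 by apply: nz; rewrite cf.
have z0 : z != 0 by apply: nz.
have wu : weight_space act _ u := act_root_space _ _ _ _ (root_vector_root_space (f, 0)) wv.
have wz : weight_space act _ z :=
  act_root_space _ _ _ _ (root_vector_root_space (finroot_opp f, (eps + eps)%:Z)) wv.
(* With gamma = -f + eps delta, these are the root vectors of gamma and -gamma. *)
pose e := root_vector R (finroot_opp f, eps%:Z).
pose e' := root_vector R (f, - eps%:Z).
have eu : act e u = 0.
  have := act_root_space _ _ _ _ (root_vector_root_space (finroot_opp f, eps%:Z)) wu.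
  by rewrite -addrA real_root_weight_addopp add0r subrK mu0.
(* The degree 2 eps of the operator defining [z] makes the total shift -eps + 2 eps - eps vanish, so
   this vector has weight [mu]. *)
have ez : act e' z = 0.
  have := act_root_space _ _ _ _ (root_vector_root_space (f, - eps%:Z)) wz.
  rewrite -addrA [X in _ + X]addrC real_root_weight_addopp PoszD addKr.
  by rewrite subrK mu0.
have [a ha] := bracket_root_vector_opp (finroot_opp f) eps%:Z.
rewrite finroot_oppK -/e -/e' in ha.
set h := coroot _ a in ha.
have fN := finroot_neq f.
have wf m : real_root_weight (f, m) h = - 2.
  by rewrite real_root_weight_coroot /= !eqxx (eq_sym _.2) (negPf fN) /=; ring.
have wof m : real_root_weight (finroot_opp f, m) h = 2.
  by rewrite real_root_weight_coroot /= !eqxx (eq_sym _.2) (negPf fN) /=; ring.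
(* The coroot has no d component, so delta vanishes on it. *)
have dh : (mu - delta *+ eps) h = mu h.
  by rewrite -[LHS]/(mu h - (delta *+ eps) h) pmulrn weightMz /delta /= mul0rz subr0.
have hu : act h u = (mu h - 2) *: u by rewrite wu -dh -(wf 0).
have hz : act h z = (mu h + 2) *: z by rewrite wz -dh -(wof (eps + eps)%:Z).
(* Each operator is nilpotent on one vector because it kills the other one. *)
have [N eN] := root_vector_locally_nilpotent _ _ irr z0 ez u.
have [M eM] := root_vector_locally_nilpotent _ _ irr u0 eu z.
have he w : act h (act e w) = act e (act h w) + 2 *: act e w.
  rewrite -[LHS](subrK (act e (act h w))) -act_bracket root_vector_root_space.
  by rewrite wof actZl addrC.
have he' w : act h (act e' w) = act e' (act h w) - 2 *: act e' w.
  rewrite -[LHS](subrK (act e' (act h w))) -act_bracket root_vector_root_space.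
  by rewrite wf actZl addrC scaleNr.
have [k hk] : exists k : nat, mu h - 2 = k%:R.
  apply: (sl2_highest_weight_nat _ _ (act e) (act e') (act h) _ u N) => //;
    try exact: act_linear.
  by move=> w; rewrite -act_bracket ha.
(* Exchanging [e] and [e'] and negating [h] turns the lowest weight vector [z] into a highest weight
   vector. *)
have [m hm] : exists m : nat, - (mu h + 2) = m%:R.
  apply: (sl2_highest_weight_nat _ _ (act e') (act e) (fun w => - act h w) _ z M) => //;
    try exact: act_linear.
  - by move=> w; rewrite -ha act_bracket opprB.
  - move=> w; rewrite he opprD; congr (_ - _).
    by rewrite -[- act h w]scaleN1r actZ scaleN1r.
  - by rewrite hz scaleNr.
(* The two natural numbers add up to (mu h - 2) - (mu h + 2) = -4. *)
have : (k + m + 4)%:R == 0 :> K.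
  by rewrite !natrD -hk -hm; apply/eqP; ring.
by rewrite pnatr_eq0 addnS.
Qed.

End Modules.

(** * From bounds at simple roots to bounds at all roots *)

(** Differences of epsilons telescope, so subadditivity becomes a triangle inequality along
    composable index pairs. *)
Lemma quasicone_data_trans (c : finroot n -> int) f g h : quasicone_data R c ->
  (finroot_val f).2 = (finroot_val g).1 ->
  finroot_val h = ((finroot_val f).1, (finroot_val g).2) -> c h <= c f + c g.
Proof.
case=> _ subadd fg hE; apply: subadd; apply: funext => x.
rewrite -[LHS]/(finroot_weight f x + finroot_weight g x) /finroot_weight hE fg /=.
by rewrite addrA subrK.
Qed.

(** Induction on the height [d.+1]: the first simple root [g] is split off from [f], leaving [h].
    For the opposite roots the pairs compose in the reverse order. *)
Lemma quasicone_data_pos_ub (c : finroot n -> int) (M : int) d f :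
  quasicone_data R c ->
  (forall i, c (simple_root i) <= M /\ c (finroot_opp (simple_root i)) <= M) ->
  ((finroot_val f).2 = (finroot_val f).1 + d.+1 :> nat)%N ->
  c f <= M * d.+1%:Z /\ c (finroot_opp f) <= M * d.+1%:Z.
Proof.
move=> qc cM; elim: d f => [|d IH] f fd.
  have f1n : ((finroot_val f).1 < n)%N by have := ltn_ord (finroot_val f).2; lia.
  have -> : f = simple_root (Ordinal f1n).
    apply: val_inj; rewrite [LHS]surjective_pairing; congr pair; apply: val_inj => //=.
    by rewrite fd addn1.
  by rewrite mulr1.
have f1n : ((finroot_val f).1 < n)%N by have := ltn_ord (finroot_val f).2; lia.
pose g := simple_root (Ordinal f1n).
pose h_val := (lift ord0 (Ordinal f1n), (finroot_val f).2).
have hN : h_val.1 != h_val.2.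
  by rewrite -val_eqE /= /bump /= fd; lia.
pose h := FinRoot hN.
have [hM ohM] : c h <= M * d.+1%:Z /\ c (finroot_opp h) <= M * d.+1%:Z.
  by apply: IH; rewrite /= /bump /= fd; lia.
have [gM ogM] : c g <= M /\ c (finroot_opp g) <= M := cM _.
have fE : finroot_val f = ((finroot_val g).1, (finroot_val h).2).
  by rewrite [LHS]surjective_pairing; congr pair; apply: val_inj.
have f_le : c f <= c g + c h by apply: quasicone_data_trans.
have of_le : c (finroot_opp f) <= c (finroot_opp h) + c (finroot_opp g).
  by apply: quasicone_data_trans => //=; congr pair; apply: val_inj.
by rewrite -[d.+2]addn1 PoszD mulrDr mulr1; split; lia.
Qed.

(** Heights are at most [n], which gives the upper bound for a root and its opposite. The lower
    bound follows from c_f >= 1 - c_(-f). *)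
Lemma quasicone_data_bounded (c : finroot n -> int) (M : int) f :
  quasicone_data R c ->
  (forall i, c (simple_root i) <= M /\ c (finroot_opp (simple_root i)) <= M) ->
  1 - M * n%:Z <= c f <= M * n%:Z.
Proof.
move=> qc cM; have [width _] := qc.
have ub g : finroot_pos g -> c g <= M * n%:Z /\ c (finroot_opp g) <= M * n%:Z.
  rewrite /finroot_pos => lt12.
  have g2n := ltn_ord (finroot_val g).2.
  have gd : ((finroot_val g).2 = (finroot_val g).1
     + ((finroot_val g).2 - (finroot_val g).1).-1.+1 :> nat)%N by lia.
  have g1n : ((finroot_val g).1 < n)%N by lia.
  have [gM ogM] := quasicone_data_pos_ub _ _ _ _ qc cM gd.
  (* A simple root gives 1 <= 2 M, so [M] is positive and the height may be replaced by [n]. *)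
  have [sM osM] := cM (Ordinal g1n); have := width (simple_root (Ordinal g1n)).
  by split; nia.
have {}ub g : c g <= M * n%:Z.
  have [gp|gN] := boolP (finroot_pos g); first by case: (ub g gp).
  have /ub[_] : finroot_pos (finroot_opp g).
    have := finroot_neq g; rewrite -val_eqE /finroot_pos /=.
    by move: gN; rewrite /finroot_pos; lia.
  by rewrite finroot_oppK.
by have := ub f; have := ub (finroot_opp f); have := width f; lia.
Qed.

End Affine.

Theorem corollary43 (R : realType) (n : nat) (n1 : (1 < n)%N) :
  finite_set [set C : set (affine R n) |
    exists c : finroot n -> int,
      [/\ quasicone_data R c, normal_form c, C = quasicone c &
      exists (V : lmodType R[i]) (act : affine R n -> V -> V),
        [/\ is_module act, irreducible act, weight_module act,
            countable_dim V & non_dense act] /\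
        exists (l mu : weight R n) (eps : nat) (v : V),
        [/\ supp act l, root_coset l mu, weight_space act mu = [set 0],
            (1 <= eps <= n)%N &
        [/\ weight_space act (mu - delta *+ eps) v, ann_is act v C &
            forall k : nat, ~ successful act (s_ n1 k) v]]]].
Proof.
(* At simple roots and their opposites the bound is 2 eps <= 2 n, and passing to all roots costs a
   factor [n]. *)
pose B := ((n + n) * n)%N.
(* Integers in [-B, B] are stored as ordinals shifted by [B]. The range of [Q] may also contain
   spans whose integers violate the quasicone inequalities; it only has to be a finite superset. *)
pose Q (g : {ffun finroot n -> 'I_(B + B).+1}) : set (affine R n) :=
  quasicone (fun f => (g f : nat)%:Z - B%:Z).
apply: (@sub_finite_set _ _ (range Q)); last exact/finite_image/finite_finset.
move=> C [c [qc [simple1 _] -> [V [act [[modV irr _ _ _]]]]]].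
move=> [_ [mu [eps [v [_ _ mu0 /andP[_ eps_n] [wv annv _]]]]]].
have cM i : c (simple_root i) <= (n + n)%:Z /\
    c (finroot_opp (simple_root i)) <= (n + n)%:Z.
  split; first by rewrite simple1; lia.
  by have := opp_root_bound _ _ _ _ modV _ _ _ _ _ irr mu0 wv annv (simple1 i); lia.
have cB f : - B%:Z <= c f <= B%:Z.
  by have := quasicone_data_bounded _ _ _ _ f qc cM; rewrite /B PoszM; lia.
exists [ffun f => inord (absz (c f + B%:Z))] => //.
rewrite {}/Q; congr quasicone; apply: funext => f.
rewrite ffunE inordK; have := cB f; clearbody B; lia.
Qed.
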